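(* Let $k$ be an algebraically closed field. For every projective variety $\mathcal{V}$ over $k$ there exists a reduced matrix pencil $P=(a,b;\alpha_1,\dots,\alpha_n)$ over $k$ with square matrices $\alpha_i$ (that is, with $a=b$) whose eigenvector variety $\epsilon(P)$ is isomorphic to $\mathcal{V}$ (as a projective variety).
   Context: A projective variety over $k$ means a Zariski closed subset of some projective space over $k$ (not necessarily irreducible). A matrix pencil $P=(a,b;\alpha_1,\dots,\alpha_n)$ over $k$ is given by $n$ linear transformations $\alpha_i\colon k^a\to k^b$, $i=1,\dots,n$ (equivalently, $n$ matrices of size $b\times a$ with coefficients in $k$), where $n,a,b$ are natural numbers. $P$ is called reduced if $\bigcap_{i=1}^n \operatorname{Ker}(\alpha_i)=0$. If $P$ is reduced, a vector $v\in k^a$ is called an eigenvector of $P$ if the subspace $\langle\alpha_1(v),\dots,\alpha_n(v)\rangle$ of $k^b$ generated by $\alpha_1(v),\dots,\alpha_n(v)$ is $1$-dimensional. Two eigenvectors are equivalent if they are (non-zero) scalar multiples of each other. The set $\epsilon(P)$ of equivalence classes of eigenvectors of $P$ is a Zariski closed subset of the projective space $\mathbb{P}(k^a)$ of one-dimensional subspaces of $k^a$, thus a projective variety; it is called the eigenvector variety of $P$. *)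

(* Defs.v *)
From HB Require Import structures.
From mathcomp Require Import all_boot all_order all_algebra.
From mathcomp Require Import mpoly.

Set Implicit Arguments.
Unset Strict Implicit.
Unset Printing Implicit Defensive.

Import GRing.Theory.
Local Open Scope ring_scope.

(* P(k^m): a point is a one-dimensional subspace of k^m, with k^m the space   *)
(* of column vectors, so P^N is [projpt k N.+1].                              *)
Definition projpt (k : fieldType) (m : nat) :=
  {L : {vspace 'cV[k]_m} | \dim L == 1%N}.

Definition evalcol (k : fieldType) (m : nat) (p : {mpoly k[m]}) (v : 'cV[k]_m)
  : k := p.@[fun i => v i 0].

Definition vanishes_at (k : fieldType) (m : nat) (p : {mpoly k[m]})
  (x : projpt k m) : Prop :=
  forall v, v \in sval x -> evalcol p v = 0.

(* The family S of equations may be infinite. *)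
Definition zariski_closed (k : fieldType) (m : nat) (V : projpt k m -> Prop)
  : Prop :=
  exists S : {mpoly k[m]} -> Prop,
    (forall p, S p -> exists d, p \is d.-homog) /\
    (forall x, V x <-> (forall p, S p -> vanishes_at p x)).

(* f is a morphism V -> W: every x in V has a Zariski open neighbourhood, here *)
(* the complement of Z in V, on which f is given by homogeneous polynomials    *)
(* F_j of one common degree. They have no common zero there, since the line    *)
(* [f y] is spanned by the vector of their values.                             *)
Definition regular_map (k : fieldType) (m n : nat) (V : projpt k m -> Prop)
  (W : projpt k n -> Prop) (f : {x | V x} -> {y | W y}) : Prop :=
  forall x : {x | V x},
  exists Z : projpt k m -> Prop,
    [/\ zariski_closed Z,
        ~ Z (sval x)
      & exists (d : nat) (F : 'I_n -> {mpoly k[m]}),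
          (forall j, F j \is d.-homog) /\
          (forall y : {x | V x}, ~ Z (sval y) ->
             forall v : 'cV[k]_m, sval (sval y) = <[v]>%VS ->
             sval (sval (f y)) = <[\col_j evalcol (F j) v]>%VS)].

Definition proj_isomorphic (k : fieldType) (m n : nat)
  (V : projpt k m -> Prop) (W : projpt k n -> Prop) : Prop :=
  exists (f : {x | V x} -> {y | W y}) (g : {y | W y} -> {x | V x}),
    [/\ regular_map f, regular_map g, cancel f g & cancel g f].

(* The matrix [P i] acts on column vectors, as a linear map k^a -> k^b. *)
Definition pencil (k : fieldType) (n a b : nat) := 'I_n -> 'M[k]_(b, a).

Definition reduced (k : fieldType) (n a b : nat) (P : pencil k n a b) : Prop :=
  forall v : 'cV[k]_a, (forall i, P i *m v = 0) -> v = 0.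

Definition eigenvector (k : fieldType) (n a b : nat) (P : pencil k n a b)
  (v : 'cV[k]_a) : Prop :=
  \dim <<[seq P i *m v | i : 'I_n]>>%VS = 1%N.

(* The class of an eigenvector v up to non-zero scalars is the line <[v]>. *)
Definition eigenvector_variety (k : fieldType) (n a b : nat)
  (P : pencil k n a b) (x : projpt k a) : Prop :=
  exists v, eigenvector P v /\ sval x = <[v]>%VS.

(* Main.v *)
Require Import Defs.
From mathcomp Require Import all_boot all_order all_algebra.
From mathcomp Require Import mpoly.
From Stdlib Require Import Classical IndefiniteDescription.

Set Implicit Arguments.
Unset Strict Implicit.
Unset Printing Implicit Defensive.

Import Order.TTheory GRing.Theory.
Local Open Scope ring_scope.

(** For a pencil P, the vectors [P i *m z] are the columns of a matrix M(z) of
linear forms in z, and z is an eigenvector exactly when M(z) has rank 1. So the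
task is to write a given projective variety as a rank 1 locus of this kind.

By Hilbert's basis theorem, finitely many of its equations suffice, and
multiplying them by powers of the variables gives equations p of one common
degree d+1 >= 1 ([closed_equal_degree]). Embed P(k^m) by the Veronese map,
whose coordinates z_mu are the monomials mu of degree d+1. Its image is the rank
1 locus of the catalecticant matrix with entries z_(nu + e_i), where the row is
indexed by i < m and the column by a monomial nu of degree d
([catalecticant_col_line]); the variety itself is cut out there by the linear
forms obtained from the p by replacing each monomial mu by z_mu
([linearization]). A linear form l is imposed by adjoining to M(z), as a new
diagonal block, the 2 x 2 matrix with l(z) twice on the diagonal: a matrix of
rank 1 has no nonzero block of this shape ([doubled_form_line]). All the blocks
coming from linear forms can share the same two rows, so that M(z) needs only
m + 2 rows, whatever the number of equations.

To have square matrices, the source is enlarged to k^m + k^2 + k^T, where the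
monomials of degree d+1 are among the elements of T: the vectors
[P i *m z] lie in k^m + k^2, and the coordinates of z that do not belong to a
monomial of degree d+1 are linear forms, which are imposed to vanish like the
others.

The Veronese map is the isomorphism from the variety to the eigenvector variety.
Its inverse is given near a point by a nonzero column of M(z), since the column
nu at the image of a vector v is v^nu v ([catalecticant_veronese]). *)

(** * Hilbert's basis theorem *)

(** Dickson's lemma, for n natural-valued measures phi on an arbitrary type.
Induction on n: let s be dominating for the first n measures, and B a bound for
[phi n] on s. An x in L with [phi n x >= B] is dominated by s; for each c < B,
apply the induction hypothesis to the part of L where [phi n] equals c. *)
Lemma dickson (T : eqType) (phi : nat -> T -> nat) (n : nat) (L : T -> Prop) :
  exists s : seq T, (forall x, x \in s -> L x) /\
    forall x, L x ->
      exists2 y, y \in s & forall i, (i < n)%N -> (phi i y <= phi i x)%N.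
Proof.
elim: n L => [|n IHn] L.
  have [[x Lx]|noL] := classic (exists x, L x); last first.
    by exists [::]; split=> // x Lx; case: noL; exists x.
  exists [:: x]; split=> [y|y _]; first by rewrite inE => /eqP->.
  by exists x; rewrite ?inE.
have [s [sL domL]] := IHn L.
have low B : exists t : seq T, (forall x, x \in t -> L x) /\
    forall x, L x -> (phi n x < B)%N ->
      exists2 y, y \in t & forall i, (i < n.+1)%N -> (phi i y <= phi i x)%N.
  elim: B => [|B [t [tL domt]]]; first by exists [::].
  have [u [uL domu]] := IHn (fun x => L x /\ phi n x = B).
  exists (t ++ u); split=> [x|x Lx].
    by rewrite mem_cat => /orP[/tL|/uL[]].
  rewrite ltnS leq_eqVlt => /orP[/eqP xB|/(domt x Lx)[y yt yx]]; last first.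
    by exists y; rewrite // mem_cat yt.
  have [y yu yx] := domu x (conj Lx xB).
  exists y => [|i]; first by rewrite mem_cat yu orbT.
  rewrite ltnS leq_eqVlt => /orP[/eqP->|]; last exact: yx.
  by rewrite (uL y yu).2 xB.
have [t [tL domt]] := low (\max_(x <- s) phi n x)%N.
exists (s ++ t); split=> [x|x Lx].
  by rewrite mem_cat => /orP[/sL|/tL].
have [/(domt x Lx)[y yt yx]|xB] := ltnP (phi n x) (\max_(x <- s) phi n x)%N.
  by exists y; rewrite // mem_cat yt orbT.
have [y ys yx] := domL x Lx; exists y => [|i]; first by rewrite mem_cat ys.
rewrite ltnS leq_eqVlt => /orP[/eqP->|]; last exact: yx.
exact: leq_trans (leq_bigmax_seq _ ys isT) xB.
Qed.

Definition ideal (R : comNzRingType) (I : R -> Prop) : Prop :=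
  [/\ I 0, forall p q, I p -> I q -> I (p + q) & forall p q, I q -> I (p * q)].

(** Take F in I such that the leading monomial of every nonzero element of I is a
multiple of that of some element of F; it exists by Dickson's lemma. Reducing
modulo F lowers leading monomials, and these are well-ordered. That F generates I
is stated as: every ideal that contains F contains I. *)
Lemma hilbert_basis (k : fieldType) (m : nat) (I : {mpoly k[m]} -> Prop) :
  ideal I ->
  exists F : seq {mpoly k[m]}, (forall f, f \in F -> I f) /\
    forall J, ideal J -> (forall f, f \in F -> J f) -> forall f, I f -> J f.
Proof.
move=> [_ ID IM].
have [F [FI domF]] := dickson (fun i (f : {mpoly k[m]}) => nth 0%N (mlead f) i)
  m (fun f => I f /\ f != 0).
exists F; split=> [f /FI[]//|J [J0 JD JM] FJ f].
move: {2}(mlead f) (erefl (mlead f)) => mu; move: mu f.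
apply: (well_founded_ind (@ltom_wf m)) => mu IH f fmu If.
have [->//|f0] := eqVneq f 0.
have [g gF gf] := domF f (conj If f0); have [Ig g0] := FI g gF.
have le_gf : (mlead g <= mlead f)%MM.
  by apply/mnm_lepP => i; rewrite !(mnm_nth 0%N); apply: gf.
pose q : {mpoly k[m]} :=
  (mleadc f / mleadc g) *: 'X_[(mlead f - mlead g)%MM].
have gN0 : mleadc g != 0 by rewrite mleadc_eq0.
have fN0 : mleadc f != 0 by rewrite mleadc_eq0.
have q0 : q != 0.
  by rewrite -mleadc_eq0 mleadcZE mleadXm mcoeffX eqxx mulr1 mulf_neq0 ?invr_neq0.
have qg : mlead (q * g) = mlead f.
  rewrite mleadM // mleadZ ?mulf_neq0 ?invr_neq0 // mleadXm.
  by rewrite submK.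
have Ir : I (f - q * g) by rewrite -mulNr; apply/ID/IM.
rewrite -(subrK (q * g) f); apply: JD; last by apply/JM/FJ.
have [->//|r0] := eqVneq (f - q * g) 0.
apply: IH (erefl _) Ir; rewrite -fmu lt_neqAle.
have := mleadB_le f (q * g); rewrite qg joinxx => ->; rewrite andbT.
apply: contra r0 => /eqP rf; rewrite -mleadc_eq0 rf mcoeffB.
have -> : (q * g)@_(mlead f) = mleadc f.
  rewrite -[in LHS]qg mleadM // mleadcM mleadcZE mleadXm mcoeffX eqxx mulr1.
  by rewrite divfK.
by rewrite subrr.
Qed.

(** An element of the ideal generated by S lies in the ideal generated by a finite
part of S; apply this to a finite set of generators. *)
Lemma finite_subfamily (k : fieldType) (m : nat) (S : {mpoly k[m]} -> Prop) :
  exists ps : seq {mpoly k[m]}, (forall p, p \in ps -> S p) /\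
    forall J, ideal J -> (forall p, p \in ps -> J p) -> forall p, S p -> J p.
Proof.
(* The ideal generated by S, with finiteness of combinations built in. *)
pose I f := exists ps : seq {mpoly k[m]}, (forall p, p \in ps -> S p) /\
  forall J, ideal J -> (forall p, p \in ps -> J p) -> J f.
have idealI : ideal I.
  split=> [|p q [ps [psS psp]] [qs [qsS qsq]]|p q [qs [qsS qsq]]].
  - by exists [::]; split=> // J [].
  - exists (ps ++ qs); split=> [r|J JI JP].
      by rewrite mem_cat => /orP[/psS|/qsS].
    have [_ JD _] := JI.
    by apply: JD; [apply: (psp J JI) | apply: (qsq J JI)] => r rs; apply: JP;
      rewrite mem_cat rs ?orbT.
  - by exists qs; split=> // J JI JP; have [_ _ JM] := JI; apply/JM/(qsq J JI).
have [F [FI genF]] := hilbert_basis idealI.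
have [ps [psS psF]] : exists ps : seq {mpoly k[m]},
    (forall p, p \in ps -> S p) /\
    forall J, ideal J -> (forall p, p \in ps -> J p) -> forall f, f \in F -> J f.
  elim: F FI {genF} => [|f F IHF] FI; first by exists [::].
  have [|ps [psS psF]] := IHF; first by move=> g gF; apply: FI; rewrite inE gF orbT.
  have [|qs [qsS qsf]] := FI f; first by rewrite inE eqxx.
  exists (ps ++ qs); split=> [p|J JI JP g].
    by rewrite mem_cat => /orP[/psS|/qsS].
  rewrite inE => /orP[/eqP->|].
    by apply: (qsf J JI) => p pqs; apply: JP; rewrite mem_cat pqs orbT.
  by apply: (psF J JI) => p pps; apply: JP; rewrite mem_cat pps.
exists ps; split=> // J JI JP p Sp; apply: (genF J JI (psF J JI JP)).
exists [:: p]; split=> [q|K _ Kp]; first by rewrite inE => /eqP->.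
by apply: Kp; rewrite inE.
Qed.

(** * Points of projective space and equations *)

Lemma projptP (k : fieldType) (m : nat) (x : projpt k m) :
  exists2 v, v != 0 & sval x = <[v]>%VS.
Proof.
case: x => L /= dimL; exists (vpick L).
  by rewrite vpick0 -dimv_eq0 (eqP dimL).
apply/eqP; rewrite eq_sym eqEdim -memvE memv_pick (eqP dimL) dim_vline.
by rewrite vpick0 -dimv_eq0 (eqP dimL).
Qed.

Lemma projpt_neq0 (k : fieldType) (m : nat) (x : projpt k m) (v : 'cV[k]_m) :
  sval x = <[v]>%VS -> v != 0.
Proof.
move=> xv; have := proj2_sig x; rewrite xv dim_vline.
by case: (v != 0).
Qed.

Lemma line_projpt (k : fieldType) (m : nat) (v : 'cV[k]_m) :
  v != 0 -> exists x : projpt k m, sval x = <[v]>%VS.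
Proof.
move=> v0; suff dimv : \dim <[v]> == 1%N by exists (exist _ <[v]>%VS dimv).
by rewrite dim_vline v0.
Qed.

Lemma lineZ (k : fieldType) (m : nat) (v : 'cV[k]_m) (c : k) :
  c != 0 -> <[c *: v]>%VS = <[v]>%VS.
Proof.
move=> c0; apply/eqP; rewrite eqEsubv -!memvE memvZ ?memv_line //=.
by apply/vlineP; exists c^-1; rewrite scalerA mulVf ?scale1r.
Qed.

Lemma evalcolZ (k : fieldType) (m d : nat) (p : {mpoly k[m]}) (c : k)
  (v : 'cV[k]_m) :
  p \is d.-homog -> evalcol p (c *: v) = c ^+ d * evalcol p v.
Proof.
move=> /dhomogP hp; rewrite /evalcol !mevalE mulr_sumr big_seq [RHS]big_seq.
apply: eq_bigr => mu /hp <-; rewrite mulrCA; congr (_ * _).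
rewrite /= mdegE -prodrXr -big_split; apply: eq_bigr => i _.
by rewrite mxE exprMn.
Qed.

Lemma vanishes_lineP (k : fieldType) (m d : nat) (p : {mpoly k[m]})
  (x : projpt k m) (v : 'cV[k]_m) :
  p \is d.-homog -> sval x = <[v]>%VS -> vanishes_at p x <-> evalcol p v = 0.
Proof.
move=> hp xv; rewrite /vanishes_at xv; split=> [|pv w /vlineP[c ->]].
  by apply; rewrite memv_line.
by rewrite (evalcolZ _ _ hp) pv mulr0.
Qed.

Lemma vanishing_ideal (k : fieldType) (m : nat) (x : projpt k m) :
  ideal (fun p : {mpoly k[m]} => vanishes_at p x).
Proof.
rewrite /vanishes_at /evalcol; split=> [v _|p q hp hq v xv|p q hq v xv].
- by rewrite meval0.
- by rewrite mevalD hp // hq // addr0.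
- by rewrite mevalM hq // mulr0.
Qed.

(** A point v has a nonzero coordinate v_i, so p vanishes at v when all the
X_i^e p do. *)
Lemma closed_equal_degree (k : fieldType) (m : nat) (V : projpt k m -> Prop) :
  zariski_closed V ->
  exists (d : nat) (ps : seq {mpoly k[m]}),
    (forall p, p \in ps -> p \is d.+1.-homog) /\
    forall x v, sval x = <[v]>%VS ->
      V x <-> (forall p, p \in ps -> evalcol p v = 0).
Proof.
move=> [S [homS VS]]; have [ps [psS genS]] := finite_subfamily S.
have homps p : p \in ps -> p \is (msize p).-1.-homog.
  by move=> /psS/homS[e]; apply: dhomog_msize.
pose d := \max_(p <- ps) msize p.
exists d, [seq 'X_i ^+ (d.+1 - (msize p).-1) * p | p <- ps, i <- enum 'I_m].
split=> [q /allpairsP[[p i] /= [pps _ ->]]|x v xv].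
  have le_pd : ((msize p).-1 <= d.+1)%N.
    by apply/(leq_trans (leq_pred _))/leqW/leq_bigmax_seq.
  rewrite -{2}(subnK le_pd); apply: dhomogM (homps p pps).
  rewrite -[X in X.-homog]mul1n; apply: dhomogMn.
  by rewrite dhomogX /= mdeg1.
rewrite VS; split=> [Sx q /allpairsP[[p i] /= [pps _ ->]]|psx p Sp].
  rewrite /evalcol mevalM [X in _ * X](_ : _ = 0) ?mulr0 //.
  exact/(vanishes_lineP (homps p pps) xv)/Sx/psS.
apply: (genS _ (vanishing_ideal x)) Sp => {}p pps.
apply/(vanishes_lineP (homps p pps) xv).
have [i vi] : exists i, v i 0 != 0.
  apply/existsP; apply: contraTT (projpt_neq0 xv).
  rewrite negb_exists negbK => /forallP v0; apply/eqP/colP => i.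
  by rewrite mxE; apply/eqP; have := v0 i; rewrite negbK.
have /eqP : evalcol ('X_i ^+ (d.+1 - (msize p).-1) * p) v = 0.
  by apply: psx; apply/allpairsP; exists (p, i); rewrite /= mem_enum.
by rewrite /evalcol mevalM rmorphXn /= mevalXU mulf_eq0 expf_eq0 (negPf vi)
           andbF => /eqP.
Qed.

(** * Pencils given by a list of matrices *)

(** The eigenvectors of a pencil depend only on the set of its matrices, so a list
serves as index set. *)
Definition pencil_of_seq (k : fieldType) (a b : nat) (s : seq 'M[k]_(b, a)) :
  pencil k (size s) a b := fun i => tnth (in_tuple s) i.

Arguments pencil_of_seq {k a b} s i.

Lemma eigenvector_pencil_of_seq (k : fieldType) (a b : nat)
  (s : seq 'M[k]_(b, a)) (z : 'cV[k]_a) :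
  eigenvector (pencil_of_seq s) z <->
  (exists w : 'cV[k]_b, forall A, A \in s -> A *m z \in <[w]>%VS) /\
  (exists2 A, A \in s & A *m z != 0).
Proof.
rewrite /eigenvector.
have -> : [seq pencil_of_seq s i *m z | i : 'I_(size s)] = [seq A *m z | A <- s].
  rewrite -[s in RHS]/(tval (in_tuple s)) -[in RHS](map_tnth_enum (in_tuple s)).
  by rewrite -map_comp.
set U := <<_>>%VS.
have memU A : A \in s -> A *m z \in U by move=> As; apply/memv_span/map_f.
have leU (W : {vspace 'cV[k]_b}) : (forall A, A \in s -> A *m z \in W) -> (U <= W)%VS.
  by move=> sW; apply/span_subvP => _ /mapP[A As ->]; apply: sW.
split=> [dimU|[[w sw] [A As Az]]].
  have [w w0 Uw] : exists2 w, w != 0 & U = <[w]>%VS.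
    have dU : \dim U == 1%N by apply/eqP.
    exact: (projptP (exist _ U dU)).
  split; first by exists w => A /memU; rewrite Uw.
  apply/hasP; apply: contraTT w0 => /hasPn noA; rewrite negbK.
  have : (U <= 0)%VS.
    by apply: leU => A /noA; rewrite negbK => /eqP->; apply: mem0v.
  by rewrite Uw -memvE memv0.
have Uw := leU _ sw; apply/eqP; rewrite eqn_leq; apply/andP; split.
  by apply: leq_trans (dimvS Uw) _; rewrite dim_vline leq_b1.
rewrite lt0n dimv_eq0; apply: contraNneq Az => U0.
by rewrite -memv0 -U0 memU.
Qed.

(** * The Veronese pencil *)

Section Veronese.

Variables (k : fieldType) (m d : nat).

(** The summands are the column height of the catalecticant matrix, the two rows
of the blocks that impose linear forms, and the coordinates of the Veronese map.
For the last, the monomials of degree at most d+1 are used because they already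
form a finite type. *)
Definition pencil_dim : nat := m + (2 + #|{: 'X_{1..m < d.+2}}|).

Implicit Types (v : 'cV[k]_m) (z w : 'cV[k]_pencil_dim) (mu nu : 'X_{1..m}).
Implicit Types (p : {mpoly k[m]}) (ps : seq {mpoly k[m]}) (l : 'rV[k]_pencil_dim).

(** Meaningful only for monomials of degree at most d+1; all others share the index
of the monomial 1. *)
Definition mon_index (mu : 'X_{1..m}) : 'I_pencil_dim :=
  rshift m (rshift 2 (enum_rank (insubd bm0 mu : 'X_{1..m < d.+2}))).

(** The value 0 marks the coordinates that are not monomials of degree d+1; they
are the ones imposed to vanish on eigenvectors. *)
Definition veronese_coord (j : 'I_pencil_dim) : {mpoly k[m]} :=
  if [pick mu : 'X_{1..m < d.+2} | (mdeg mu == d.+1) && (mon_index mu == j)] is Some mu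
  then 'X_[mu] else 0.

Definition veronese (v : 'cV[k]_m) : 'cV[k]_pencil_dim :=
  \col_j evalcol (veronese_coord j) v.

Lemma mon_index_inj mu nu : (mdeg mu <= d.+1)%N -> (mdeg nu <= d.+1)%N ->
  mon_index mu = mon_index nu -> mu = nu.
Proof.
move=> dmu dnu /rshift_inj/rshift_inj/enum_rank_inj/(congr1 val) /=.
by rewrite !val_insubd !ltnS dmu dnu.
Qed.

Lemma veronese_coord_index mu :
  mdeg mu = d.+1 -> veronese_coord (mon_index mu) = 'X_[mu].
Proof.
move=> dmu; rewrite /veronese_coord; case: pickP => [nu /andP[/eqP dnu]|none].
  by move=> /eqP/mon_index_inj <-; rewrite ?dmu ?dnu.
have bmu : (mdeg mu < d.+2)%N by rewrite dmu.
by have := none (BMultinom bmu); rewrite /= dmu !eqxx.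
Qed.

Lemma veronese_coord_neq0 j :
  veronese_coord j != 0 -> exists2 mu, mdeg mu = d.+1 & j = mon_index mu.
Proof.
rewrite /veronese_coord; case: pickP => [mu /andP[/eqP dmu /eqP <-] _|_].
  by exists mu.
by rewrite eqxx.
Qed.

Lemma veronese_coord_homog j : veronese_coord j \is d.+1.-homog.
Proof.
have [->|/veronese_coord_neq0[mu dmu ->]] := eqVneq (veronese_coord j) 0.
  exact: dhomog0.
by rewrite veronese_coord_index // dhomogX /= dmu.
Qed.

Lemma veronese_index v mu :
  mdeg mu = d.+1 -> veronese v (mon_index mu) 0 = evalcol 'X_[mu] v.
Proof. by move=> dmu; rewrite mxE veronese_coord_index. Qed.

Lemma veroneseZ c v : veronese (c *: v) = c ^+ d.+1 *: veronese v.
Proof.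
by apply/colP => j; rewrite !mxE (evalcolZ _ _ (veronese_coord_homog j)).
Qed.

Lemma evalcolXU mu i (v : 'cV[k]_m) :
  evalcol 'X_[(mu + U_(i))%MM] v = evalcol 'X_[mu] v * v i 0.
Proof. by rewrite /evalcol mpolyXD mevalM mevalXU. Qed.

Lemma evalcol_power i e (v : 'cV[k]_m) :
  evalcol 'X_[(U_(i) *+ e)%MM] v = v i 0 ^+ e.
Proof. by rewrite /evalcol -mpolyXn rmorphXn /= mevalXU. Qed.

Definition catalecticant_col (nu : 'X_{1..m}) (z : 'cV[k]_pencil_dim) : 'cV[k]_m :=
  \col_i z (mon_index (nu + U_(i))) 0.

Definition catalecticant_mx (nu : 'X_{1..m}) : 'M[k]_pencil_dim :=
  col_mx (\matrix_(i, j) (j == mon_index (nu + U_(i)))%:R) 0.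

Lemma mul_catalecticant_mx nu z :
  catalecticant_mx nu *m z = col_mx (catalecticant_col nu z) 0.
Proof.
rewrite mul_col_mx mul0mx; congr col_mx; apply/colP => i; rewrite !mxE.
rewrite (bigD1 (mon_index (nu + U_(i)))) //= mxE eqxx mul1r big1 ?addr0 // => j.
by rewrite mxE => /negPf->; rewrite mul0r.
Qed.

Lemma catalecticant_veronese nu v : mdeg nu = d ->
  catalecticant_col nu (veronese v) = evalcol 'X_[nu] v *: v.
Proof.
move=> dnu; apply/colP => i; rewrite !mxE.
by rewrite veronese_coord_index ?evalcolXU // mdegD mdeg1 dnu addn1.
Qed.

Lemma catalecticant_colZ nu c z :
  catalecticant_col nu (c *: z) = c *: catalecticant_col nu z.
Proof. by apply/colP => i; rewrite !mxE. Qed.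

(** For i = 0, 1, these matrices map z to l(z) times the two basis vectors of the
summand k^2. *)
Definition doubled_form_mx (l : 'rV[k]_pencil_dim) (i : 'I_2) : 'M[k]_pencil_dim :=
  col_mx 0 (col_mx (delta_mx i 0 *m l) 0).

Lemma mul_doubled_form_mx l i z :
  doubled_form_mx l i *m z =
  col_mx 0 (col_mx ((l *m z) 0 0 *: (delta_mx i 0 : 'cV[k]_2)) 0).
Proof.
rewrite !mul_col_mx !mul0mx -mulmxA {1}[l *m z]mx11_scalar.
by rewrite mul_mx_scalar.
Qed.

(** If l(z) is not 0, the two vectors on the line are linearly independent. *)
Lemma doubled_form_line l z w :
  (forall i, doubled_form_mx l i *m z \in <[w]>%VS) -> (l *m z) 0 0 = 0.
Proof.
move=> lw; apply/eqP/negPn/negP => lz0.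
have /vlineP[a aw] := lw 0; have /vlineP[b bw] := lw 1.
rewrite !mul_doubled_form_mx in aw bw; move: ((l *m z) 0 0) => c in lz0 aw bw.
have : a *: (b *: w) = b *: (a *: w) by rewrite !scalerA mulrC.
rewrite -aw -bw !scale_col_mx !scaler0.
move=> /eq_col_mx[_ /eq_col_mx[+ _]] => /colP/(_ 0).
rewrite !mxE /= !mulr0 !mulr1 => /esym/eqP.
rewrite mulf_eq0 (negPf lz0) orbF => /eqP b0.
move: bw; rewrite b0 scale0r => /eqP; rewrite !col_mx_eq0 => /and3P[_ + _].
by move=> /eqP/colP/(_ 1); rewrite !mxE /= mulr1; apply/eqP.
Qed.

(** The coefficients in degree at most d+1 are taken, which is all of them for the
equations of degree d+1 to which this is applied. *)
Definition linearization (p : {mpoly k[m]}) : 'rV[k]_pencil_dim :=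
  \sum_(mu : 'X_{1..m < d.+2}) p@_mu *: delta_mx 0 (mon_index mu).

Lemma linearizationE p z :
  (linearization p *m z) 0 0 =
  \sum_(mu : 'X_{1..m < d.+2}) p@_mu * z (mon_index mu) 0.
Proof.
rewrite mulmx_suml summxE; apply: eq_bigr => mu _.
by rewrite -scalemxAl mxE -rowE mxE.
Qed.

Lemma linearization_veronese p v : p \is d.+1.-homog ->
  (linearization p *m veronese v) 0 0 = evalcol p v.
Proof.
move=> /[dup] hp /dhomogP supp_p; rewrite linearizationE.
have sp : (msize p <= d.+2)%N.
  by rewrite msizeE; apply/bigmax_leqP_seq => mu /supp_p /= ->.
rewrite [in RHS](mpolywE sp) /evalcol raddf_sum; apply: eq_bigr => mu _ /=.
rewrite mevalZ; have [dmu|/(dhomog_nemf_coeff hp)->] := eqVneq (mdeg mu) d.+1.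
  by rewrite veronese_index.
by rewrite !mul0r.
Qed.

Lemma mdegS_split e (mu : 'X_{1..m}) :
  mdeg mu = e.+1 -> exists nu i, mu = (nu + U_(i))%MM /\ mdeg nu = e.
Proof.
move=> dmu; have /existsP[i mui] : [exists i, mu i != 0%N].
  apply: contra_eqT dmu => /existsPn mu0; rewrite mdegE big1 // => i _.
  by apply/eqP; have := mu0 i; rewrite negbK.
have le_i : (U_(i) <= mu)%MM by rewrite lep1mP.
exists (mu - U_(i))%MM, i; rewrite submK //; split=> //.
by move: dmu; rewrite -{1}(submK le_i) mdegD mdeg1 addn1 => -[].
Qed.

(** A point where the catalecticant matrix has rank 1 is a Veronese point. If
each column nu is y_nu v, then z_(nu + e_i) v_j = y_nu v_i v_j =
z_(nu + e_j) v_i for all i and j. Fixing j = i0 with v_j nonzero, repeated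
exchange moves all of a monomial mu of degree d+1 into the variable i0, giving
z_mu v_j^(d+1) = v^mu z_((d+1) e_j). *)
Lemma catalecticant_col_line z v i0 :
  v i0 0 != 0 ->
  (forall j, veronese_coord j = 0 -> z j 0 = 0) ->
  (forall nu, mdeg nu = d -> catalecticant_col nu z \in <[v]>%VS) ->
  exists c, z = c *: veronese v.
Proof.
move=> vi0 z0 zv.
have exchange nu i : mdeg nu = d ->
    z (mon_index (nu + U_(i))) 0 * v i0 0 = v i 0 * z (mon_index (nu + U_(i0))) 0.
  move=> /zv/vlineP[y /colP yv]; have := yv i; have := yv i0; rewrite !mxE.
  by move=> -> ->; rewrite [RHS]mulrCA mulrA.
(* The exchange, done for the e variables of kappa one at a time. *)
have power e kappa : (e <= d.+1)%N -> mdeg kappa = e ->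
    z (mon_index (kappa + U_(i0) *+ (d.+1 - e))) 0 * v i0 0 ^+ e =
    evalcol 'X_[kappa] v * z (mon_index (U_(i0) *+ d.+1)) 0.
  elim: e kappa => [|e IHe] kappa le_ed.
    move/eqP; rewrite mdeg_eq0 => /eqP->.
    by rewrite expr0 mulr1 subn0 add0m /evalcol mpolyX0 meval1 mul1r.
  move=> /mdegS_split[nu [i [-> dnu]]].
  rewrite subSS evalcolXU exprS -addmA (addmC U_(i)%MM) addmA mulrA exchange.
    rewrite -addmA -mulmSr -subSn // -mulrA IHe ?(ltnW le_ed) //.
    by rewrite mulrCA mulrA.
  by rewrite mdegD mdegMn mdeg1 mul1n dnu subnKC.
exists (z (mon_index (U_(i0) *+ d.+1)) 0 / v i0 0 ^+ d.+1); apply/colP => j.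
rewrite mxE.
have [cj|/veronese_coord_neq0[mu dmu ->]] := eqVneq (veronese_coord j) 0.
  by rewrite mxE cj z0 // /evalcol meval0 mulr0.
rewrite veronese_index // mulrAC [X in X / _]mulrC -(power _ mu (leqnn _) dmu).
rewrite subnn mulm0n addm0.
by rewrite mulfK // expf_neq0.
Qed.

Definition imposed_forms (ps : seq {mpoly k[m]}) : seq 'rV[k]_pencil_dim :=
  [seq delta_mx 0 j | j <- enum 'I_pencil_dim & veronese_coord j == 0] ++
  [seq linearization p | p <- ps].

Definition veronese_matrices (ps : seq {mpoly k[m]}) : seq 'M[k]_pencil_dim :=
  [seq catalecticant_mx nu
     | nu : 'X_{1..m < d.+1} <- enum {: 'X_{1..m < d.+1}} & mdeg nu == d] ++
  [seq doubled_form_mx l i | l <- imposed_forms ps, i <- enum 'I_2].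

Lemma catalecticant_mem ps nu :
  mdeg nu = d -> catalecticant_mx nu \in veronese_matrices ps.
Proof.
move=> dnu; have bnu : (mdeg nu < d.+1)%N by rewrite dnu.
rewrite mem_cat; apply/orP; left; apply/mapP.
by exists (BMultinom bnu); rewrite // mem_filter /= dnu eqxx mem_enum.
Qed.

Lemma doubled_form_mem ps l i :
  l \in imposed_forms ps -> doubled_form_mx l i \in veronese_matrices ps.
Proof.
move=> lps; rewrite mem_cat; apply/orP; right; apply/allpairsP.
by exists (l, i); rewrite /= mem_enum.
Qed.

Lemma veronese_matricesP ps A : A \in veronese_matrices ps ->
  (exists2 nu, mdeg nu = d & A = catalecticant_mx nu) \/
  (exists l i, l \in imposed_forms ps /\ A = doubled_form_mx l i).
Proof.
rewrite mem_cat => /orP[/mapP[nu]|/allpairsP[[l i] /= [lps _ ->]]].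
  by rewrite mem_filter => /andP[/eqP dnu _] ->; left; exists (bmnm nu).
by right; exists l, i.
Qed.

Lemma imposed_forms_coord ps z :
  (forall l, l \in imposed_forms ps -> (l *m z) 0 0 = 0) ->
  forall j, veronese_coord j = 0 -> z j 0 = 0.
Proof.
move=> lz j cj; have := lz (delta_mx 0 j); rewrite -rowE mxE; apply.
rewrite mem_cat; apply/orP; left; apply: map_f.
by rewrite mem_filter cj eqxx mem_enum.
Qed.

Lemma imposed_forms_veronese ps v :
  (forall p, p \in ps -> p \is d.+1.-homog) ->
  (forall p, p \in ps -> evalcol p v = 0) ->
  forall l, l \in imposed_forms ps -> (l *m veronese v) 0 0 = 0.
Proof.
move=> hps psv l; rewrite mem_cat => /orP[/mapP[j]|/mapP[p pps ->]].
  rewrite mem_filter => /andP[/eqP cj _] ->.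
  by rewrite -rowE !mxE cj /evalcol meval0.
by rewrite linearization_veronese ?hps ?psv.
Qed.

(** Every monomial of degree d+1 is some nu + e_i, so its coordinate is an entry of
the catalecticant matrix. *)
Lemma zero_of_catalecticant z :
  (forall j, veronese_coord j = 0 -> z j 0 = 0) ->
  (forall nu, mdeg nu = d -> catalecticant_col nu z = 0) -> z = 0.
Proof.
move=> z0 cz; apply/colP => j; rewrite mxE.
have [/z0//|/veronese_coord_neq0[mu /mdegS_split[nu [i [-> dnu]]] ->]] :=
  eqVneq (veronese_coord j) 0.
by have /colP/(_ i) := cz nu dnu; rewrite !mxE.
Qed.

Lemma reduced_veronese ps : reduced (pencil_of_seq (veronese_matrices ps)).
Proof.
move=> z Pz; have {}Pz A : A \in veronese_matrices ps -> A *m z = 0.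
  by move=> /(tnthP (in_tuple _))[i ->]; apply: Pz.
apply: zero_of_catalecticant => [|nu dnu].
  apply: (@imposed_forms_coord ps) => l lps; apply: (@doubled_form_line _ _ 0) => i.
  by rewrite Pz ?mem0v // doubled_form_mem.
have := Pz _ (catalecticant_mem ps dnu).
by rewrite mul_catalecticant_mx -[0 in RHS]col_mx0 => /eq_col_mx[].
Qed.

(** The imposed forms vanish at the Veronese image of v, and each catalecticant
column there is a multiple of v; the column of the monomial X_i^d is v_i^d v,
nonzero for a suitable i. *)
Lemma eigenvector_veronese ps v :
  (forall p, p \in ps -> p \is d.+1.-homog) -> v != 0 ->
  (forall p, p \in ps -> evalcol p v = 0) ->
  eigenvector (pencil_of_seq (veronese_matrices ps)) (veronese v).
Proof.
move=> hps v0 psv; apply/eigenvector_pencil_of_seq; split.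
  exists (col_mx v 0) => A /veronese_matricesP[[nu dnu ->]|[l [i [lps ->]]]].
    rewrite mul_catalecticant_mx catalecticant_veronese //.
    rewrite -[X in col_mx _ X](scaler0 _ (evalcol 'X_[nu] v)) -scale_col_mx.
    exact/memvZ/memv_line.
  rewrite mul_doubled_form_mx (imposed_forms_veronese hps psv) // scale0r !col_mx0.
  exact: mem0v.
have /cV0Pn[i vi] := v0.
have dnu : mdeg (U_(i) *+ d)%MM = d by rewrite mdegMn mdeg1 mul1n.
exists (catalecticant_mx (U_(i) *+ d)); first exact: catalecticant_mem.
rewrite mul_catalecticant_mx catalecticant_veronese // evalcol_power.
rewrite col_mx_eq0 eqxx andbT scaler_eq0 negb_or v0 andbT.
by rewrite expf_neq0.
Qed.

(** At an eigenvector z the imposed forms vanish, so the line spanned by the vectors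
[P i *m z] comes from a nonzero catalecticant column v, to which all the other
columns are proportional. *)
Lemma eigenvector_veroneseP ps z :
  (forall p, p \in ps -> p \is d.+1.-homog) ->
  eigenvector (pencil_of_seq (veronese_matrices ps)) z ->
  exists v, [/\ v != 0, forall p, p \in ps -> evalcol p v = 0
    & exists2 c, c != 0 & z = c *: veronese v].
Proof.
move=> hps /eigenvector_pencil_of_seq[[w sw] [A As Az]].
have lz l : l \in imposed_forms ps -> (l *m z) 0 0 = 0.
  by move=> lps; apply: (@doubled_form_line _ _ w) => i; apply/sw/doubled_form_mem.
have [[nu dnu defA]|[l [i [lps defA]]]] := veronese_matricesP As; last first.
  by move: Az; rewrite defA mul_doubled_form_mx lz // scale0r !col_mx0 eqxx.
move: Az; rewrite {}defA mul_catalecticant_mx col_mx_eq0 eqxx andbT.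
set v := catalecticant_col nu z => v0.
have zv nu' : mdeg nu' = d -> catalecticant_col nu' z \in <[v]>%VS.
  move=> /(catalecticant_mem ps)/sw; rewrite mul_catalecticant_mx => /vlineP[b bw].
  have := sw _ (catalecticant_mem ps dnu); rewrite mul_catalecticant_mx.
  move=> /vlineP[a aw]; have a0 : a != 0.
    apply: contraNneq v0 => a0; move: aw.
    by rewrite a0 scale0r -[0 in RHS]col_mx0 => /eq_col_mx[/eqP].
  have : col_mx (catalecticant_col nu' z) 0 = (b / a) *: col_mx v 0 :> 'cV_pencil_dim.
    by rewrite aw bw scalerA divfK.
  by rewrite scale_col_mx => /eq_col_mx[-> _]; apply/memvZ/memv_line.
have /cV0Pn[i vi] := v0.
have [c zc] := catalecticant_col_line vi (imposed_forms_coord lz) zv.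
have c0 : c != 0.
  apply: contraNneq v0 => c0; rewrite /v zc c0 scale0r.
  by apply/eqP/colP => j; rewrite !mxE.
exists v; split=> // [p pps|]; last by exists c.
have := lz (linearization p); rewrite zc -scalemxAr mxE.
rewrite linearization_veronese ?hps //.
have -> : linearization p \in imposed_forms ps by rewrite mem_cat map_f ?orbT.
by move=> /(_ isT)/eqP; rewrite mulf_eq0 (negPf c0) => /eqP.
Qed.

Lemma veronese_neq0 v : v != 0 -> veronese v != 0.
Proof.
move=> /cV0Pn[i vi]; apply/cV0Pn; exists (mon_index (U_(i) *+ d.+1)).
rewrite veronese_index ?evalcol_power ?expf_neq0 //.
by rewrite mdegMn mdeg1 mul1n.
Qed.

(** Injectivity: applying the catalecticant column of X_i^d to a Veronese point
recovers v_i^d v. *)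
Lemma line_veronese v (w : 'cV[k]_m) : v != 0 -> w != 0 ->
  <[v]>%VS = <[w]>%VS <-> <[veronese v]>%VS = <[veronese w]>%VS.
Proof.
move=> v0 w0; split=> vw.
  have /vlineP[c cw] : v \in <[w]>%VS by rewrite -vw memv_line.
  rewrite cw veroneseZ lineZ // expf_neq0 //.
  by apply: contraNneq v0 => c0; rewrite cw c0 scale0r.
have /vlineP[c cw] : veronese v \in <[veronese w]>%VS by rewrite -vw memv_line.
have /cV0Pn[i vi] := v0.
have dnu : mdeg (U_(i) *+ d)%MM = d by rewrite mdegMn mdeg1 mul1n.
have := congr1 (catalecticant_col (U_(i) *+ d)) cw.
rewrite catalecticant_colZ !catalecticant_veronese // !evalcol_power.
rewrite scalerA => vcw; rewrite -(lineZ v (expf_neq0 d vi)) vcw lineZ //.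
apply: contraNneq v0 => c0; move/eqP: vcw.
by rewrite c0 scale0r scaler_eq0 expf_eq0 (negPf vi) andbF.
Qed.

End Veronese.

(** * The isomorphism *)

Lemma point_eq (k : fieldType) (m : nat) (V : projpt k m -> Prop)
  (x y : {x | V x}) : sval (sval x) = sval (sval y) -> x = y.
Proof.
move: x y => [x Vx] [y Vy] /= /val_inj xy; rewrite -xy in Vy *.
by rewrite (proof_irrelevance _ Vx Vy).
Qed.

Lemma regular_veronese (k : fieldType) (m d : nat) (V : projpt k m -> Prop)
  (W : projpt k (pencil_dim m d) -> Prop) (f : {x | V x} -> {y | W y}) :
  (forall x v, sval (sval x) = <[v]>%VS ->
     sval (sval (f x)) = <[veronese d v]>%VS) ->
  regular_map f.
Proof.
move=> fE x; exists (fun _ => False); split=> //.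
  exists (fun p => p = 1); split=> [p ->|y].
    by exists 0%N; apply: dhomog1.
  split=> // /(_ 1 erefl 0 (mem0v _)) /eqP.
  by rewrite /evalcol meval1 oner_eq0.
exists d.+1, (@veronese_coord k m d); split=> [j|y _ v yv].
  exact: veronese_coord_homog.
exact: fE.
Qed.

(** If v_i is nonzero, the inverse is given near the image of v by the
catalecticant column of X_i^d, whose entries are coordinates, thus forms of degree
1. The excluded closed set Z is where this column vanishes. *)
Lemma regular_veronese_inverse (k : fieldType) (m d : nat)
  (V : projpt k m -> Prop) (W : projpt k (pencil_dim m d) -> Prop)
  (g : {y | W y} -> {x | V x}) :
  (forall y, exists v, sval (sval (g y)) = <[v]>%VS /\
     sval (sval y) = <[veronese d v]>%VS) ->
  regular_map g.
Proof.
move=> gE y; have [v [gv yv]] := gE y; have v0 := projpt_neq0 gv.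
have /cV0Pn[i vi] := v0; pose nu := (U_(i) *+ d)%MM.
have dnu : mdeg nu = d by rewrite mdegMn mdeg1 mul1n.
pose F j : {mpoly k[pencil_dim m d]} := 'X_(mon_index d (nu + U_(j))).
have homF j : F j \is 1.-homog by rewrite dhomogX /= mdeg1.
have FE u : \col_j evalcol (F j) u = catalecticant_col nu u.
  by apply/colP => j; rewrite !mxE /evalcol mevalXU.
pose Z x := forall p, (exists j, p = F j) -> vanishes_at p x.
have ZP x u : sval x = <[u]>%VS -> Z x <-> catalecticant_col nu u = 0.
  move=> xu; rewrite -FE; split=> [Zx|/colP Fu p [j ->]].
    by apply/colP => j; rewrite !mxE; apply/(vanishes_lineP (homF j) xu)/Zx; exists j.
  by apply/(vanishes_lineP (homF j) xu); have := Fu j; rewrite !mxE.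
exists Z; split.
- exists (fun p => exists j, p = F j); split=> // p [j ->]; by exists 1%N.
- move/(ZP _ _ yv)/eqP; rewrite catalecticant_veronese // evalcol_power.
  by rewrite scaler_eq0 expf_eq0 (negPf vi) andbF (negPf v0).
- exists 1%N, F; split=> // x notZx u xu; have [w [gw xw]] := gE x.
  rewrite FE gw; have /vlineP[c uc] : u \in <[veronese d w]>%VS.
    by rewrite -xw xu memv_line.
  have : catalecticant_col nu u != 0 by apply/eqP => /(ZP _ _ xu).
  rewrite uc catalecticant_colZ catalecticant_veronese // scalerA.
  by rewrite scaler_eq0 negb_or => /andP[cw _]; rewrite lineZ.
Qed.

Theorem mainTheorem2 (k : closedFieldType) (m : nat)
  (V : projpt k m -> Prop) (hV : zariski_closed V) :
  exists (n a : nat) (P : pencil k n a a),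
    reduced P /\ proj_isomorphic (eigenvector_variety P) V.
Proof.
have [d [ps [homps VE]]] := closed_equal_degree hV.
exists _, (pencil_dim m d), (pencil_of_seq (veronese_matrices d ps)).
split; first exact: reduced_veronese.
set E := eigenvector_variety _.
have EV (y : {y | E y}) : exists x : {x | V x}, exists v,
    sval (sval x) = <[v]>%VS /\ sval (sval y) = <[veronese d v]>%VS.
  have [z [eigz ->]] := proj2_sig y.
  have [v [v0 psv [c c0 ->]]] := eigenvector_veroneseP homps eigz.
  have [x xv] := line_projpt v0.
  by exists (exist _ x ((VE x v xv).2 psv)), v; rewrite lineZ.
have VtoE (x : {x | V x}) : exists y : {y | E y}, exists v,
    sval (sval x) = <[v]>%VS /\ sval (sval y) = <[veronese d v]>%VS.
  case: x => x Vx; have [v v0 xv] := projptP x.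
  have [y yv] := line_projpt (veronese_neq0 d v0).
  have Ey : E y.
    exists (veronese d v); split=> //.
    exact: (eigenvector_veronese homps v0 ((VE x v xv).1 Vx)).
  by exists (exist _ y Ey), v.
have [f fE] := functional_choice _ EV; have [g gE] := functional_choice _ VtoE.
exists f, g; split.
- exact: regular_veronese_inverse fE.
- apply: regular_veronese => x v xv; have [w [xw ->]] := gE x.
  apply/(line_veronese d (projpt_neq0 xw) (projpt_neq0 xv)).
  by rewrite -xw.
- move=> y; apply: point_eq; have [w [yw ->]] := gE (f y).
  have [v [fv ->]] := fE y.
  apply/(line_veronese d (projpt_neq0 yw) (projpt_neq0 fv)).
  by rewrite -yw.
- move=> x; apply: point_eq; have [w [fw gw]] := fE (g x).
  have [v [xv gv]] := gE x; rewrite xv fw.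
  apply/(line_veronese d (projpt_neq0 fw) (projpt_neq0 xv)).
  by rewrite -gw.
Qed.
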